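(* Let $n\ge 1$. For a permutation $\pi\in S_3$ of $\{1,2,4\}$, denote also by $\pi$ the linear extension to $\mathcal A_n$ of the digitwise action of $\pi$ on $\Delta_n$. If $\pi\in S_3$ is even, then $$\pi(XY)=\pi(X)\pi(Y)\qquad\text{for all }X,Y\in\mathcal A_n.$$ If $\pi\in S_3$ is odd, then $$\pi(XY)=\pi(Y)\pi(X)\qquad\text{for all }X,Y\in\mathcal A_n.$$
   Context: $\Delta_n=\{1,2,4,7\}^n$ is the set of words of length $n$. Digits are identified with quaternionic symbols: $1=i$, $2=j$, $4=k$, $7=e$, where $e$ is the identity, $i^2=j^2=k^2=-e$, $ij=k=-ji$, $jk=i=-kj$, $ki=j=-ik$. Words are multiplied coordinate by coordinate, with the local quaternionic signs collected into one global sign. $\mathcal A_n$ is the real algebra with basis $\Delta_n$ and product extended bilinearly (so $\mathcal A_n\cong\mathbb H^{\otimes n}$). The group $S_3$ of permutations of $\{1,2,4\}$ acts on $\Delta_n$ by permuting the digits $1,2,4$ in each position and fixing the digit $7$. *)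

(* Defs.v *)
(** The algebra A_n with basis the words over the digits 1, 2, 4, 7 read as
    the quaternionic symbols i, j, k, e. *)
From HB Require Import structures.
From mathcomp Require Import all_boot all_order all_algebra all_fingroup.
From mathcomp Require Import reals.

Set Implicit Arguments.
Unset Strict Implicit.
Unset Printing Implicit Defensive.

Import GRing.Theory.
Local Open Scope ring_scope.

Inductive imdigit := D1 | D2 | D4.

Definition nat_of_imdigit (d : imdigit) : nat :=
  match d with D1 => 1 | D2 => 2 | D4 => 4 end.

Definition imdigit_of_nat (m : nat) : option imdigit :=
  match m with 1 => Some D1 | 2 => Some D2 | 4 => Some D4 | _ => None end.

Lemma nat_of_imdigitK : pcancel nat_of_imdigit imdigit_of_nat.
Proof. by case. Qed.

HB.instance Definition _ := Countable.copy imdigit (pcan_type nat_of_imdigitK).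

Lemma imdigit_enumP : Finite.axiom [:: D1; D2; D4].
Proof. by case. Qed.

HB.instance Definition _ := isFinite.Build imdigit imdigit_enumP.

(* [None] is the digit 7, so that a permutation of {1, 2, 4} is a plain
   [{perm imdigit}] and acts on digits by [omap]. *)
Definition digit := option imdigit.

(* [(s, c)] stands for the signed digit (-1)^s c. *)
Definition dmul (a b : digit) : bool * digit :=
  match a, b with
  | None, _ => (false, b)
  | _, None => (false, a)
  | Some D1, Some D1 | Some D2, Some D2 | Some D4, Some D4 => (true, None)
  | Some D1, Some D2 => (false, Some D4)
  | Some D2, Some D1 => (true,  Some D4)
  | Some D2, Some D4 => (false, Some D1)
  | Some D4, Some D2 => (true,  Some D1)
  | Some D4, Some D1 => (false, Some D2)
  | Some D1, Some D4 => (true,  Some D2)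
  end.

Definition word (n : nat) := n.-tuple digit.

Definition wmul n (u v : word n) : word n :=
  [tuple (dmul (tnth u i) (tnth v i)).2 | i < n].

Definition wsign n (u v : word n) : bool :=
  \big[addb/false]_(i < n) (dmul (tnth u i) (tnth v i)).1.

Definition perm_word n (p : {perm imdigit}) (w : word n) : word n :=
  [tuple of map (omap p) w].

(* An element is its family of coordinates in the basis of words.  This is an
   alias because [{ffun _ -> _}] carries the pointwise product. *)
Definition qalg (R : comNzRingType) (n : nat) := {ffun word n -> R^o}.

HB.instance Definition _ (R : comNzRingType) n :=
  GRing.Lmodule.copy (qalg R n) {ffun word n -> R^o}.

Definition qword (R : comNzRingType) n (w : word n) : qalg R n :=
  [ffun x => (x == w)%:R].

Definition qone (R : comNzRingType) n : qalg R n :=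
  qword R [tuple None | _ < n].

Definition qmul (R : comNzRingType) n (X Y : qalg R n) : qalg R n :=
  \sum_u \sum_v (X u * Y v) *: ((-1) ^+ wsign u v *: qword R (wmul u v)).

Definition perm_qalg (R : comNzRingType) n (p : {perm imdigit}) (X : qalg R n) :
    qalg R n :=
  \sum_w X w *: qword R (perm_word p w).

Section Algebra.
Variables (R : comNzRingType) (n : nat).
Implicit Types (X Y Z : qalg R n) (u v w : word n).

Lemma qword_sum X : X = \sum_w X w *: qword R w.
Proof.
apply/ffunP=> x; rewrite sum_ffunE (bigD1 x) //= big1 ?addr0.
  by rewrite !ffunE eqxx /GRing.scale /= mulr1.
by move=> w nwx; rewrite !ffunE eq_sym (negbTE nwx) scaler0.
Qed.

Lemma qmulDl : left_distributive (@qmul R n) +%R.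
Proof.
move=> X Y Z; rewrite /qmul -big_split; apply: eq_bigr => u _ /=.
rewrite -big_split; apply: eq_bigr => v _ /=.
by rewrite ffunE mulrDl scalerDl.
Qed.

Lemma qmulDr : right_distributive (@qmul R n) +%R.
Proof.
move=> X Y Z; rewrite /qmul -big_split; apply: eq_bigr => u _ /=.
rewrite -big_split; apply: eq_bigr => v _ /=.
by rewrite ffunE mulrDr scalerDl.
Qed.

Lemma qmulZl (a : R) X Y : qmul (a *: X) Y = a *: qmul X Y.
Proof.
rewrite /qmul scaler_sumr; apply: eq_bigr => u _.
rewrite scaler_sumr; apply: eq_bigr => v _.
by rewrite ffunE [RHS]scalerA mulrA.
Qed.

Lemma qmulZr (a : R) X Y : qmul X (a *: Y) = a *: qmul X Y.
Proof.
rewrite /qmul scaler_sumr; apply: eq_bigr => u _.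
rewrite scaler_sumr; apply: eq_bigr => v _.
by rewrite ffunE [RHS]scalerA mulrCA.
Qed.

Lemma qmul_word u v :
  qmul (qword R u) (qword R v) = (-1) ^+ wsign u v *: qword R (wmul u v).
Proof.
rewrite /qmul (bigD1 u) //= [X in _ + X]big1 ?addr0 => [|x nx].
  rewrite (bigD1 v) //= [X in _ + X]big1 ?addr0 => [|y ny].
    by rewrite !ffunE !eqxx mulr1 scale1r.
  by rewrite !ffunE (negbTE ny) mulr0 scale0r.
by apply: big1 => y _; rewrite !ffunE (negbTE nx) mul0r scale0r.
Qed.

Lemma wmulA : associative (@wmul n).
Proof.
move=> u v w; apply: eq_from_tnth => i; rewrite !tnth_mktuple.
by case: (tnth u i) (tnth v i) (tnth w i) => [[]|] [[]|] [[]|].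
Qed.

Lemma wsignA u v w :
  wsign u (wmul v w) (+) wsign v w = wsign u v (+) wsign (wmul u v) w.
Proof.
rewrite /wsign -!big_split; apply: eq_bigr => i _ /=; rewrite !tnth_mktuple.
by case: (tnth u i) (tnth v i) (tnth w i) => [[]|] [[]|] [[]|].
Qed.

Lemma qmul_linl Y : linear (fun X => qmul X Y).
Proof. by move=> a X Z; rewrite qmulDl qmulZl. Qed.

Lemma qmul_linr X : linear (qmul X).
Proof. by move=> a Y Z; rewrite qmulDr qmulZr. Qed.

Lemma eq_linear_qword (f g : qalg R n -> qalg R n) : linear f -> linear g ->
  (forall w, f (qword R w) = g (qword R w)) -> f =1 g.
Proof.
have zero (h : qalg R n -> qalg R n) : linear h -> h 0 = 0.
  by move=> lh; have := lh (-1) 0 0; rewrite !scaleN1r !addNr.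
move=> lf lg eq_fg X; rewrite (qword_sum X).
elim/big_rec: _ => [|w Y _ IH]; first by rewrite !zero.
by rewrite lf lg eq_fg IH.
Qed.

Lemma qmulA : associative (@qmul R n).
Proof.
move=> X Y Z; move: X; apply: eq_linear_qword => [||u].
- exact: qmul_linl.
- by move=> a X X'; rewrite !qmul_linl.
move: Y; apply: eq_linear_qword => [||v].
- by move=> a Y Y'; rewrite qmul_linl qmul_linr.
- by move=> a Y Y'; rewrite qmul_linr qmul_linl.
move: Z; apply: eq_linear_qword => [||w].
- by move=> a Z Z'; rewrite !qmul_linr.
- exact: qmul_linr.
rewrite !qmul_word qmulZr qmulZl !qmul_word !scalerA wmulA; congr (_ *: _).
by rewrite -!signr_addb addbC wsignA.
Qed.

Lemma qmul1l : left_id (qone R n) (@qmul R n).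
Proof.
apply: eq_linear_qword => [||w] //; first exact: qmul_linr.
rewrite qmul_word /wsign big1 => [|i _]; last by rewrite tnth_mktuple.
rewrite scale1r; congr (qword R _).
by apply: eq_from_tnth => i; rewrite !tnth_mktuple.
Qed.

Lemma qmul1r : right_id (qone R n) (@qmul R n).
Proof.
apply: eq_linear_qword => [||w] //; first exact: qmul_linl.
rewrite qmul_word /wsign big1 => [|i _].
  rewrite scale1r; congr (qword R _).
  by apply: eq_from_tnth => i; rewrite !tnth_mktuple; case: (tnth w i) => [[]|].
by rewrite tnth_mktuple; case: (tnth w i) => [[]|].
Qed.

Lemma qone_neq0 : qone R n != 0.
Proof.
apply/eqP=> /ffunP/(_ [tuple None | _ < n])/eqP.
by rewrite !ffunE eqxx oner_eq0.
Qed.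

HB.instance Definition _ := GRing.Zmodule_isNzRing.Build (qalg R n)
  qmulA qmul1l qmul1r qmulDl qmulDr qone_neq0.

HB.instance Definition _ := GRing.Lmodule_isLalgebra.Build R (qalg R n)
  (fun a X Y => esym (qmulZl a X Y)).

HB.instance Definition _ := GRing.Lalgebra_isAlgebra.Build R (qalg R n)
  (fun a X Y => esym (qmulZr a X Y)).

Lemma qalg_mulE X Y : X * Y = qmul X Y.
Proof. by []. Qed.

End Algebra.

(* Main.v *)
(** On digits, every transposition of {i, j, k} reverses products, keeping
    signs.  Since transpositions generate S_3, a permutation preserves or
    reverses products of digits according to its parity; this passes to words
    coordinatewise and to the algebra by bilinearity. *)
Require Import Defs.
From HB Require Import structures.
From mathcomp Require Import all_boot all_order all_algebra all_fingroup.
From mathcomp Require Import reals.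

Set Implicit Arguments.
Unset Strict Implicit.
Unset Printing Implicit Defensive.

Import GRing.Theory.
Local Open Scope ring_scope.

(** A transposition reverses the cyclic order i, j, k and so flips the sign of a product of two
    distinct units; exchanging the factors flips it back. Squares and products with e are
    insensitive to both. *)
Lemma dmul_tperm (x y : imdigit) (a b : digit) : x != y ->
  dmul (omap (tperm x y) b) (omap (tperm x y) a) =
  ((dmul a b).1, omap (tperm x y) (dmul a b).2).
Proof.
by move=> nxy; move: x y nxy a b => [] [] //= _ [[]|] [[]|] //=; rewrite !permE.
Qed.

(** Putting the parity inside the statement treats both cases at once, which lets the induction on a
    factorization into transpositions go through. *)
Lemma dmul_perm (p : {perm imdigit}) (a b : digit) :
  dmul (omap p (if odd_perm p then b else a))
       (omap p (if odd_perm p then a else b)) =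
  ((dmul a b).1, omap p (dmul a b).2).
Proof.
have [ts -> nts] := prod_tpermP p.
elim: ts nts a b => [_|[x y] ts IH /andP[/= nxy nts]] a b.
  rewrite big_nil odd_perm1.
  have omap1 c : omap (1%g : {perm imdigit}) c = c.
    by case: c => //= c; rewrite perm1.
  by rewrite !omap1; case: (dmul a b).
rewrite big_cons; set q := (\prod_(t <- ts) _)%g in IH *.
have omapM c : omap (tperm x y * q)%g c = omap q (omap (tperm x y) c).
  by case: c => //= c; rewrite permM.
rewrite odd_permM odd_tperm nxy !omapM.
(* In [tperm x y * q] the transposition acts first and has already reversed the factors, so the
   hypothesis for [q] is taken at the exchanged digits. *)
have := IH nts (omap (tperm x y) b) (omap (tperm x y) a);
rewrite dmul_tperm //= => <-.
by case: (odd_perm q).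
Qed.

Lemma wmul_perm n (p : {perm imdigit}) (u v : word n) :
  wmul (perm_word p (if odd_perm p then v else u))
       (perm_word p (if odd_perm p then u else v)) = perm_word p (wmul u v).
Proof.
apply: eq_from_tnth => i; rewrite tnth_mktuple !tnth_map tnth_ord_tuple.
have := congr1 snd (dmul_perm p (tnth u i) (tnth v i)).
by case: (odd_perm p).
Qed.

Lemma wsign_perm n (p : {perm imdigit}) (u v : word n) :
  wsign (perm_word p (if odd_perm p then v else u))
        (perm_word p (if odd_perm p then u else v)) = wsign u v.
Proof.
apply: eq_bigr => i _; rewrite !tnth_map.
have := congr1 fst (dmul_perm p (tnth u i) (tnth v i)).
by case: (odd_perm p).
Qed.

Lemma perm_qalg_linear (R : comNzRingType) n (p : {perm imdigit}) :
  linear (@perm_qalg R n p).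
Proof.
move=> a X Y; rewrite /perm_qalg scaler_sumr -big_split.
by apply: eq_bigr => w _; rewrite !ffunE scalerDl [in RHS]scalerA.
Qed.

Lemma perm_qalg_word (R : comNzRingType) n (p : {perm imdigit}) (w : word n) :
  perm_qalg p (qword R w) = qword R (perm_word p w).
Proof.
rewrite /perm_qalg (bigD1 w) //= big1 => [|x nx].
  by rewrite ffunE eqxx scale1r addr0.
by rewrite ffunE (negbTE nx) scale0r.
Qed.

Lemma perm_qalg_mul (R : comNzRingType) n (p : {perm imdigit})
    (X Y : qalg R n) :
  perm_qalg p (X * Y) =
  perm_qalg p (if odd_perm p then Y else X) *
  perm_qalg p (if odd_perm p then X else Y).
Proof.
have permL := @perm_qalg_linear R n p.
move: X; apply: eq_linear_qword => [a X X'|a X X'|u].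
- by rewrite mulrDl -scalerAl permL.
(* The parity decides on which side [X] stands, hence which distributivity law applies. *)
- by case: odd_perm; rewrite permL ?mulrDl ?mulrDr -?scalerAl -?scalerAr.
move: Y; apply: eq_linear_qword => [a Y Y'|a Y Y'|v].
- by rewrite mulrDr -scalerAr permL.
- by case: odd_perm; rewrite permL ?mulrDl ?mulrDr -?scalerAl -?scalerAr.
(* Homogeneity carries the global sign of a product of words through [perm_qalg p]. *)
have permZ a X : perm_qalg p (a *: X) = a *: perm_qalg p X :> qalg R n.
  have perm0 : perm_qalg p 0 = 0 :> qalg R n.
    by have := permL (-1) 0 0; rewrite !scaleN1r !addNr.
  by rewrite -[a *: X]addr0 permL perm0 addr0.
rewrite qalg_mulE qmul_word permZ perm_qalg_word -wmul_perm -(wsign_perm p u v).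
by case: odd_perm; rewrite !perm_qalg_word !qalg_mulE qmul_word.
Qed.

Theorem proposition5p1 (R : realType) (n : nat) (n_ge1 : (1 <= n)%N)
    (p : {perm imdigit}) :
  (~~ odd_perm p ->
     forall X Y : qalg R n, perm_qalg p (X * Y) = perm_qalg p X * perm_qalg p Y) /\
  (odd_perm p ->
     forall X Y : qalg R n, perm_qalg p (X * Y) = perm_qalg p Y * perm_qalg p X).
Proof.
by split=> [/negbTE|] podd X Y; rewrite perm_qalg_mul podd.
Qed.
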